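(* Let $A=(a_1,\dots,a_n)$ be a finite sequence and $k$ a positive integer. Let $s$ be a non-negative real-valued function on the blocks of $A$ such that (i) $s(\emptyset)=0$ and $s(B)\ge 0$ for every block $B$, and (iii) $|s(B_1)-s(B_2)|\le 1$ whenever the blocks $B_1$ and $B_2$ differ by one element (their symmetric difference consists of exactly one term). Then there is a partition of $A$ into $k$ blocks $B_1,\dots,B_k$ such that $|s(B_i)-s(B_j)|\le 2$ for all $i,j\in[k]$.
   Context: A block of $A$ is either the empty set or a set of consecutive terms $\{a_i,a_{i+1},\dots,a_j\}$ with $i\le j$ (regarded as the set of positions $\{i,\dots,j\}$). A partition of $A$ into $k$ blocks is an ordered tuple $(B_1,\dots,B_k)$ given by integers $0=x_0\le x_1\le\dots\le x_k=n$ with $B_i=\{a_j:x_{i-1}<j\le x_i\}$; empty blocks are allowed. *)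

(* Defs.v *)
From HB Require Import structures.
From mathcomp Require Import all_boot all_order all_algebra.
From mathcomp Require Import reals.

Set Implicit Arguments.
Unset Strict Implicit.
Unset Printing Implicit Defensive.

(* Positions of A are numbered from 0, as elements of 'I_(size A); blocks are
   sets of positions, so the values of the terms of A play no role. *)
Definition is_block (T : Type) (A : seq T) (B : {set 'I_(size A)}) : Prop :=
  B = set0 \/
  exists i j : 'I_(size A), i <= j /\ B = [set l : 'I_(size A) | i <= l <= j].

(* The term at 0-based position l is the (l+1)-st one, so the condition
   x_i < l+1 <= x_(i+1) reads x i <= l < x i.+1.  Only x 0, ..., x k matter. *)
Definition is_block_partition (T : Type) (A : seq T) (k : nat)
    (B : k.-tuple {set 'I_(size A)}) : Prop :=
  exists x : nat -> nat,
    [/\ x 0 = 0,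
        x k = size A,
        forall i : nat, i < k -> x i <= x i.+1
      & forall i : 'I_k,
          tnth B i = [set l : 'I_(size A) | x i <= l < x i.+1]].

Definition differ_by_one (T : finType) (B1 B2 : {set T}) : Prop :=
  #|(B1 :\: B2) :|: (B2 :\: B1)| = 1.

(* Main.v *)
Require Import Defs.
From HB Require Import structures.
From mathcomp Require Import all_boot all_order all_algebra all_fingroup.
From mathcomp Require Import reals zify lra.

(** Fix a fine grid {0, ..., nN}^(k-1).  A grid point, made monotone by running
    maxima, cuts [0, n] into k intervals whose end points are multiples of 1/N;
    the value of such a fractional interval is the average of s over the N
    integer intervals obtained by rounding both end points with a common shift
    i/N.  Label the grid point by a non-degenerate interval of largest value.
    Sperner's lemma on the cube, in Kuhn's form, gives a small simplex carrying
    all k labels, hence a fractional partition whose k values agree up to 4/N.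
    Rounding with the middle shift moves each end point by at most 1/2, so
    each value changes by at most 1, and the rounded values differ by at most
    2 + 4/N; as s takes finitely many values, N large gives the bound 2.

    For Sperner's lemma, the number of fully labelled simplices mod 2 is the sum
    over all Kuhn simplices of the determinant over F_2 of the 0/1 matrix of
    labels; it is computed by a discrete Stokes formula and induction on the
    dimension. *)

Set Implicit Arguments.
Unset Strict Implicit.
Unset Printing Implicit Defensive.

Import Order.TTheory GRing.Theory Num.Theory.
Local Open Scope ring_scope.

(** * Kuhn simplices and label determinants mod 2 *)

(** Equal to 1 exactly when [l] is a bijection onto 0, ..., n-1: a repeated label gives equal rows,
    a label out of range a zero row. *)
Definition label_det n (l : 'I_n -> nat) : 'F_2 :=
  \det (\matrix_(i < n, j < n) (l i == j)%:R).

Lemma eq_label_det n (l l' : 'I_n -> nat) :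
  l =1 l' -> label_det l = label_det l'.
Proof.
by move=> ll'; congr (\det _); apply/matrixP => i j; rewrite !mxE ll'.
Qed.

Lemma label_det_eq0 n (l : 'I_n -> nat) (j : 'I_n) :
  (forall i, l i != j) -> label_det l = 0.
Proof.
move=> lj; rewrite /label_det (expand_det_col _ j) big1 // => i _.
by rewrite mxE (negPf (lj i)) mul0r.
Qed.

Lemma pchar_F2 : 2%N \in [pchar 'F_2].
Proof. exact: pchar_Fp. Qed.

(* The rows of the label matrix sum to 1, so applying the adjugate to the
   all-ones column expresses the determinant as a sum of maximal minors. *)
Lemma label_det_facets n (l : 'I_n.+1 -> nat) :
  (forall i, (l i <= n)%N) ->
  label_det l = \sum_j label_det (fun i => l (lift j i)).
Proof.
move=> ln; rewrite /label_det; set A := \matrix_(_, _) _.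
have A1 : A *m const_mx 1 = const_mx 1 :> 'cV_n.+1.
  apply/matrixP => i k; rewrite !mxE (bigD1 (Ordinal (ln i : l i < n.+1)%N)) //=.
  rewrite big1 ?addr0 => [|j]; first by rewrite !mxE eqxx mul1r.
  by rewrite -val_eqE /= !mxE eq_sym => /negPf->; rewrite mul0r.
have := congr1 (fun B => (\adj A *m B) ord_max ord0) A1.
rewrite mulmxA mul_adj_mx mul_scalar_mx !mxE mulr1 => ->.
apply: eq_bigr => j _; rewrite !mxE mulr1 /cofactor.
rewrite -signr_odd; have -> (b : bool) : (-1) ^+ b = 1 :> 'F_2.
  by case: b; rewrite ?expr1 ?(oppr_pchar2 pchar_F2).
rewrite mul1r; congr (\det _); apply/matrixP => i c.
by rewrite !mxE /= /bump leqNgt ltn_ord.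
Qed.

(* [p c] is the time at which coordinate [c] is incremented. *)
Definition kuhn_vertex d (x : 'I_d -> nat) (p : 'S_d) (j : nat) :
  {ffun 'I_d -> nat} := [ffun c => (x c + (p c < j))%N].

(** Corners have type ['I_m.+1] though they stay below [m], so that the faces x c = m are sums over
    the same type. *)
Definition kuhn_sum d m (L : {ffun 'I_d -> nat} -> nat) : 'F_2 :=
  \sum_(x : {ffun 'I_d -> 'I_m.+1} | [forall c, x c < m]%N) \sum_(p : 'S_d)
    label_det (fun i : 'I_d.+1 => L (kuhn_vertex (fun c => x c) p i)).

(** A transposition exchanges even and odd permutations, so the sum has two equal halves, which
    cancel in characteristic 2. *)
Lemma sum_perm_tperm0 d (F : 'S_d -> 'F_2) (a b : 'I_d) : a != b ->
  (forall p, F (p * tperm a b)%g = F p) -> \sum_p F p = 0.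
Proof.
move=> ab Ft; rewrite (bigID (@odd_perm _)) /=.
rewrite [X in X + _](reindex_inj (mulIg (tperm a b))) /=.
rewrite (eq_bigl (fun p : 'S_d => ~~ odd_perm p)); last first.
  by move=> p; rewrite odd_permM odd_tperm ab addbT.
by rewrite (eq_bigr _ (fun p _ => Ft p)) (addrr_pchar2 pchar_F2).
Qed.

(* An inner facet of a Kuhn simplex is shared with the simplex obtained by
   swapping two consecutive steps. *)
Lemma kuhn_inner_facet0 d (L : {ffun 'I_d -> nat} -> nat) x (j : 'I_d.+1) :
  j != ord0 -> j != ord_max ->
  \sum_p label_det (fun i : 'I_d => L (kuhn_vertex x p (lift j i))) = 0.
Proof.
case: d => [|d] in L x j * => j0 jd; first by rewrite ord1 in j0.
have jgt0 : (0 < j)%N by rewrite lt0n.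
have jltd : (j < d.+1)%N by rewrite ltn_neqAle jd -ltnS ltn_ord.
have jltd' : (j.-1 < d.+1)%N by lia.
pose a := Ordinal jltd'; pose b := Ordinal jltd.
have ab : a != b by rewrite -val_eqE /=; lia.
apply: (sum_perm_tperm0 ab) => p.
apply: eq_label_det => i; congr (L _); apply/ffunP => c; rewrite !ffunE permM.
congr (_ + nat_of_bool _)%N.
have ji : (lift j i != j :> nat) by rewrite eq_sym neq_lift.
case: tpermP => [->|->|//] /=; rewrite /= in ji *; lia.
Qed.

(** [ord_pred] is cyclic: it sends [ord0] to [n], which is not below [i]. *)
Lemma ltn_ord_pred n (t : 'I_n.+1) i : (i <= n)%N ->
  (ord_pred t < i)%N = (t != ord0) && (t < i.+1)%N.
Proof.
move=> ilen; rewrite -val_eqE /=; case: t => -[|t] /= tn.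
  by rewrite modn_small; lia.
by rewrite modnDr modn_small //; lia.
Qed.

(* The first facet of a Kuhn simplex is the last facet of the simplex that
   performs the first step at the very end. *)
Lemma kuhn_first_facet d (x : 'I_d.+1 -> nat) (p : 'S_d.+1) (i : 'I_d.+1) :
  let q := (p * perm (@ord_pred_inj d.+1))%g in
  kuhn_vertex x p i.+1 =
  kuhn_vertex (fun c => (x c + (q c == ord_max))%N) q i.
Proof.
move=> q; apply/ffunP => c; rewrite !ffunE /q permM permE.
rewrite ltn_ord_pred; last by rewrite -ltnS.
rewrite -addnA; congr (_ + _)%N.
have -> : (ord_pred (p c) == ord_max) = (p c == ord0).
  rewrite -(inj_eq (@ord_pred_inj d.+1) (p c)); congr (_ == _).
  by apply: val_inj; rewrite /= modn_small.
by case: eqP => [->|].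
Qed.

(** * Discrete Stokes formula and Sperner's lemma on the cube *)

(** After the shift, coordinate [c] runs over 1, ..., m instead of 0, ..., m-1; the common range
    cancels mod 2 and two opposite faces remain. *)
Lemma sum_shift_coord d m (c : 'I_d) (G : ('I_d -> nat) -> 'F_2) :
  (0 < m)%N -> (forall x y, x =1 y -> G x = G y) ->
  \sum_(x : {ffun 'I_d -> 'I_m.+1} | [forall b, x b < m]%N)
     (G (fun b => (x b + (b == c))%N) + G (fun b => x b)) =
  \sum_(x : {ffun 'I_d -> 'I_m.+1} |
     (x c == m :> nat) && [forall b, (b != c) ==> (x b < m)%N]) G (fun b => x b) +
  \sum_(x : {ffun 'I_d -> 'I_m.+1} |
     (x c == 0 :> nat)%N && [forall b, x b < m]%N) G (fun b => x b).
Proof.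
move=> m0 Gext; rewrite big_split /=.
have sub1_ltn k : (k < m.+1)%N -> (k - 1 < m)%N by lia.
have midE k : (k < m.+1)%N ->
    ((k < m) && (k != 0) = (0 < k) && (k != m :> nat))%N by lia.
have subaddK k (b : bool) : (b -> 0 < k)%N -> (k - b + b)%N = k.
  by case: b; lia.
pose up (x : {ffun 'I_d -> 'I_m.+1}) : {ffun 'I_d -> 'I_m.+1} :=
  [ffun b => inord (x b + (b == c))].
pose dn (x : {ffun 'I_d -> 'I_m.+1}) : {ffun 'I_d -> 'I_m.+1} :=
  [ffun b => inord (x b - (b == c))].
pose Q (x : {ffun 'I_d -> 'I_m.+1}) := [forall b, (b != c) ==> (x b < m)%N].
have cubeE (x : {ffun 'I_d -> 'I_m.+1}) : [forall b, x b < m]%N = Q x && (x c < m)%N.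
  apply/forallP/andP => [xm|[/forallP xm xc] b].
    by split=> //; apply/forallP => b; apply/implyP.
  by have := xm b; case: eqP => [->|].
have dnE x b : (dn x b = x b - (b == c) :> nat)%N.
  by rewrite ffunE inordK // ltnS (leq_trans (leq_subr _ _)) // -ltnS.
have upE (x : {ffun 'I_d -> 'I_m.+1}) b :
    (x b + (b == c) <= m)%N -> (up x b = x b + (b == c) :> nat)%N.
  by move=> h; rewrite ffunE inordK.
have -> : \sum_(x : {ffun 'I_d -> 'I_m.+1} | [forall b, x b < m]%N)
    G (fun b => (x b + (b == c))%N) =
    \sum_(x : {ffun 'I_d -> 'I_m.+1} | Q x && (0 < x c)%N) G (fun b => x b).
  rewrite (reindex_onto dn up) => [|x /forallP xm]; last first.
    apply/ffunP => b; apply: val_inj; rewrite /= dnE upE ?addnK //.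
    by have := xm b; case: (b == c) => /=; lia.
  apply: eq_big => [x|x /andP[/forallP xm /eqP ex]].
    apply/andP/andP => [[/forallP xm /eqP ex]|[/forallP xm xc]].
      split.
        apply/forallP => b; apply/implyP => /negPf bc.
        by have := xm b; rewrite dnE bc subn0.
      rewrite -ex upE ?eqxx ?addn1 //; exact: xm.
    split.
      apply/forallP => b; have := xm b; rewrite dnE.
      case: eqP => [->|_] /=; last by rewrite subn0.
      by rewrite sub1_ltn.
    have xb b : (b == c -> 0 < x b)%N by move/eqP->.
    apply/eqP/ffunP => b; apply: val_inj; rewrite /= upE dnE subaddK //.
    - exact: xb.
    - by rewrite -ltnS.
    - exact: xb.
  by apply: Gext => b; rewrite -[in RHS]ex upE //;
    move: (xm b); case: (b == c); rewrite ?addn0 ?addn1 //; apply: ltnW.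
rewrite (bigID (fun x : {ffun 'I_d -> 'I_m.+1} => x c == m :> nat)) /=.
rewrite [X in _ + X](bigID (fun x : {ffun 'I_d -> 'I_m.+1} => x c == 0 :> nat)%N) /=.
set a := \sum_(x | _) _; set b := \sum_(x | _) _.
set a' := \sum_(x | _) _; set b' := \sum_(x | _) _.
have -> : b' = b.
  by apply: eq_bigl => x; rewrite cubeE -!andbA midE.
rewrite addrACA (addrr_pchar2 pchar_F2) addr0; congr (_ + _); apply: eq_bigl => x.
  rewrite -/(Q x); case: (Q x); rewrite ?andbF ?andbT //=.
  by case: eqP => [->|]; rewrite ?m0 ?andbF.
by rewrite andbC.
Qed.


Lemma reindex_lift_perm_max d (F : 'S_d.+1 -> 'F_2) :
  \sum_(q : 'S_d.+1 | q ord_max == ord_max) F q =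
  \sum_(p : 'S_d) F (lift_perm ord_max ord_max p).
Proof.
rewrite (reindex (lift_perm ord_max ord_max)) /=.
  by apply: eq_bigl => p; rewrite lift_perm_id eqxx.
(* The inverse of [lift_perm]; the default [k] is never reached, since [q] is injective. *)
pose rf (q : 'S_d.+1) k := odflt k (unlift (q ord_max) (q (lift ord_max k))).
have rfK (q : 'S_d.+1) k : lift (q ord_max) (rf q k) = q (lift ord_max k).
  rewrite /rf; have := neq_lift ord_max k.
  by rewrite -(inj_eq (@perm_inj _ q)) => /unlift_some[? ? ->].
have rf_inj q : injective (rf q).
  move=> k k' /(congr1 (lift (q ord_max))); rewrite !rfK.
  by move=> /perm_inj /lift_inj.
exists (fun q => perm (rf_inj q)) => [p _|q].
  by apply/permP => k; rewrite permE /rf lift_perm_lift lift_perm_id liftK.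
rewrite inE => /eqP qmax; apply/permP => k.
case: (unliftP ord_max k) => [k'|] ->; rewrite ?lift_perm_id //.
by rewrite lift_perm_lift permE -{1}qmax rfK.
Qed.

Definition snoc_coord d T (z : {ffun 'I_d -> T}) (t : T) : {ffun 'I_d.+1 -> T} :=
  [ffun b => if unlift ord_max b is Some b' then z b' else t].

Lemma reindex_snoc_coord d m (F : {ffun 'I_d.+1 -> 'I_m.+1} -> 'F_2) :
  \sum_(x : {ffun 'I_d.+1 -> 'I_m.+1} | (x ord_max == m :> nat) &&
      [forall b, (b != ord_max) ==> (x b < m)%N]) F x =
  \sum_(z : {ffun 'I_d -> 'I_m.+1} | [forall b, z b < m]%N)
      F (snoc_coord z ord_max).
Proof.
rewrite (reindex_onto (fun z => snoc_coord z ord_max)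
    (fun x => [ffun b => x (lift ord_max b)])) /=; last first.
  move=> x /andP[/eqP xm _]; apply/ffunP => b; rewrite ffunE.
  case: unliftP => [b'|] ->; first by rewrite ffunE.
  exact: val_inj.
apply: eq_bigl => z; rewrite ffunE unlift_none eqxx /=.
have -> : [ffun b => snoc_coord z ord_max (lift ord_max b)] = z.
  by apply/ffunP => b; rewrite !ffunE liftK.
rewrite eqxx andbT; apply/forallP/forallP => zm b.
  by have := zm (lift ord_max b); rewrite ffunE liftK eq_sym neq_lift.
apply/implyP; rewrite ffunE; case: unliftP => [b'|] -> //.
by rewrite eqxx.
Qed.

(** The last coordinate has increment time [d], too late for any vertex [i <= d], so it stays at
    [m]. *)
Lemma kuhn_vertex_snoc d m (z : {ffun 'I_d -> 'I_m.+1}) (p : 'S_d) (i : 'I_d.+1) :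
  kuhn_vertex (fun c => snoc_coord z ord_max c) (lift_perm ord_max ord_max p) i =
  snoc_coord (kuhn_vertex (fun c => z c) p i) m.
Proof.
apply/ffunP => c; rewrite !ffunE; case: unliftP => [c'|] ->.
  by rewrite lift_perm_lift lift_max ffunE.
by rewrite lift_perm_id /= ltnNge -ltnS ltn_ord addn0.
Qed.

(** Only facets on the boundary survive mod 2, and the only face that can carry all of 0, ..., d-1
    is the one where the last coordinate is [m], a cube of lower dimension. *)
Lemma kuhn_sum_eq1 d m (L : {ffun 'I_d -> nat} -> nat) : (0 < m)%N ->
  (forall x : {ffun 'I_d -> nat}, (forall c, x c <= m)%N -> (L x <= d)%N) ->
  (forall (x : {ffun 'I_d -> nat}) c,
     (forall b, x b <= m)%N -> x c = 0%N -> L x != c) ->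
  (forall (x : {ffun 'I_d -> nat}) c,
     (forall b, x b <= m)%N -> x c = m -> (L x <= c)%N) ->
  kuhn_sum m L = 1.
Proof.
move=> m0; elim: d L => [|d IHd] L Lle L0 Lm.
  rewrite /kuhn_sum (big_pred1 [ffun=> ord0]); last first.
    move=> x; have -> : x = [ffun=> ord0] by apply/ffunP => -[].
    by rewrite /= eqxx; apply/forallP => -[].
  rewrite (big_pred1 1%g) => [|p]; last first.
    by rewrite (_ : p = 1%g) /= ?eqxx //; apply/permP => -[].
  rewrite /label_det det_mx11 mxE /=.
  by set v := kuhn_vertex _ _ _; have /(_ v): _ := Lle; rewrite leqn0 => -> // -[].
pose G (q : 'S_d.+1) (y : 'I_d.+1 -> nat) :=
  label_det (fun i : 'I_d.+1 => L (kuhn_vertex y q i)).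
have Gext q x y : x =1 y -> G q x = G q y.
  move=> xy; apply: eq_label_det => i; congr L; apply/ffunP => c.
  by rewrite !ffunE xy.
have vle (x : {ffun 'I_d.+1 -> 'I_m.+1}) (q : 'S_d.+1) i :
    (forall b, (x b < m)%N || (i <= q b)%N) ->
    forall b, (kuhn_vertex (fun c => x c) q i b <= m)%N.
  by move=> xm b; rewrite ffunE; have := xm b; have := ltn_ord (x b); lia.
(* First facets are rewritten as last facets, the corner moving one step in the direction of the
   last step of [q]. *)
have -> : kuhn_sum m L = \sum_(q : 'S_d.+1)
    \sum_(x : {ffun 'I_d.+1 -> 'I_m.+1} | [forall b, x b < m]%N)
     (G q (fun b => (x b + (b == q^-1%g ord_max))%N) + G q (fun b => x b)).
  rewrite exchange_big; apply: eq_bigr => x /forallP xm.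
  transitivity (\sum_(p : 'S_d.+1) \sum_(j : 'I_d.+2)
      label_det (fun i => L (kuhn_vertex (fun c => x c) p (lift j i)))).
    apply: eq_bigr => p _; rewrite label_det_facets // => i.
    by apply/Lle/vle => b; rewrite xm.
  rewrite exchange_big (bigD1 ord0) //= (bigD1 ord_max) //=.
  rewrite [X in _ + (_ + X)]big1 ?addr0 => [|j /andP[j0 jm]];
    last exact: kuhn_inner_facet0.
  rewrite big_split; congr (_ + _); last first.
    apply: eq_bigr => p _; apply: eq_label_det => i.
    by congr (L (kuhn_vertex _ _ _)); exact: lift_max.
  rewrite [RHS](reindex_inj (mulIg (perm (@ord_pred_inj d.+1)))) /=.
  apply: eq_bigr => p _; apply: eq_label_det => i.
  transitivity (L (kuhn_vertex (fun c => x c) p i.+1)); first by [].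
  rewrite kuhn_first_facet.
  congr L; apply/ffunP => c; rewrite !ffunE; congr (_ + nat_of_bool _ + _)%N.
  by rewrite -[in RHS](inj_eq (@perm_inj _ (p * perm (@ord_pred_inj d.+1))%g)) permKV.
under eq_bigr => q _ do (rewrite sum_shift_coord //; last exact: Gext).
(* On the face x c = 0, label [c] does not occur. *)
rewrite big_split /= [X in _ + X]big1 ?addr0 => [|q _]; last first.
  rewrite big1 // => x /andP[/eqP xc /forallP xm].
  apply: (label_det_eq0 (j := q^-1%g ord_max)) => i.
  apply: L0; first by apply: vle => b; rewrite xm.
  by rewrite ffunE permKV xc /= ltnNge -ltnS ltn_ord.
rewrite (bigID (fun q : 'S_d.+1 => q ord_max == ord_max)) /=.
(* On a face x c = m with c below [ord_max], labels are at most c, so [ord_max] is missing. *)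
rewrite [X in _ + X]big1 ?addr0 => [|q qmax]; last first.
  rewrite big1 // => x /andP[/eqP xc /forallP xm].
  have cmax : q^-1%g ord_max != ord_max.
    by apply: contraNneq qmax => /(congr1 q); rewrite permKV => <-.
  apply: (label_det_eq0 (j := ord_max)) => i; rewrite neq_ltn; apply/orP; left.
  apply: (@leq_ltn_trans (q^-1%g ord_max)); last first.
    by rewrite ltn_neqAle cmax -ltnS ltn_ord.
  apply: Lm.
    apply: vle => b; have := xm b; case: eqP => [-> _|_ /= -> //].
    by rewrite permKV /= (leq_ord i) orbT.
  by rewrite ffunE permKV xc /= ltnNge -ltnS ltn_ord addn0.
rewrite reindex_lift_perm_max -(IHd (fun z => L (snoc_coord z m))).
- rewrite /kuhn_sum [RHS]exchange_big; apply: eq_bigr => p _.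
  rewrite lift_permV lift_perm_id reindex_snoc_coord; apply: eq_bigr => z _.
  by apply: eq_label_det => i; rewrite kuhn_vertex_snoc.
- move=> z zm; apply: (Lm _ ord_max); last by rewrite ffunE unlift_none.
  by move=> b; rewrite ffunE; case: unliftP.
- move=> z c zm zc; rewrite -(lift_max c); apply: L0.
    by move=> b; rewrite ffunE; case: unliftP.
  by rewrite ffunE liftK.
- move=> z c zm zc; rewrite -(lift_max c); apply: Lm.
    by move=> b; rewrite ffunE; case: unliftP.
  by rewrite ffunE liftK.
Qed.

(** Some simplex has a non-zero determinant, and a missing label would give a zero column. *)
Lemma cubical_sperner d m (L : {ffun 'I_d -> nat} -> nat) : (0 < m)%N ->
  (forall x : {ffun 'I_d -> nat}, (forall c, x c <= m)%N -> (L x <= d)%N) ->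
  (forall (x : {ffun 'I_d -> nat}) c,
     (forall b, x b <= m)%N -> x c = 0%N -> L x != c) ->
  (forall (x : {ffun 'I_d -> nat}) c,
     (forall b, x b <= m)%N -> x c = m -> (L x <= c)%N) ->
  exists2 x : {ffun 'I_d -> nat}, (forall c, x c < m)%N &
    forall j : 'I_d.+1, exists2 y : {ffun 'I_d -> nat},
      (forall c, x c <= y c <= (x c).+1)%N & L y = j.
Proof.
move=> m0 Lle L0 Lm; have := kuhn_sum_eq1 m0 Lle L0 Lm.
pose F (x : {ffun 'I_d -> 'I_m.+1}) (p : 'S_d) :=
  label_det (fun i : 'I_d.+1 => L (kuhn_vertex (fun c => x c) p i)).
have [/existsP[x /andP[/forallP xm /existsP[p Fxp]]] _|none] :=
    boolP [exists x : {ffun 'I_d -> 'I_m.+1},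
      [forall c, x c < m]%N && [exists p, F x p != 0]]; last first.
  move=> /eqP; rewrite /kuhn_sum big1 ?(eq_sym 0) ?oner_eq0 // => x xm.
  rewrite big1 // => p _; apply: contraNeq none => Fxp.
  by apply/existsP; exists x; rewrite xm; apply/existsP; exists p.
exists [ffun c => x c : nat] => [c|j]; first by rewrite ffunE.
have [/existsP[i /eqP Lj]|/existsPn none] :=
    boolP [exists i : 'I_d.+1, L (kuhn_vertex (fun c => x c) p i) == j].
  exists (kuhn_vertex (fun c => x c) p i) => // c.
  by rewrite !ffunE leq_addr /=; case: (p c < i)%N; rewrite ?addn1 ?addn0.
by rewrite /F (label_det_eq0 none) eqxx in Fxp.
Qed.

(** * Lipschitz functions of two end points and their averages *)

Lemma nat_lipschitz (R : realDomainType) (f : nat -> R) :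
  (forall a, `|f a - f a.+1| <= 1) ->
  forall a b, `|f a - f b| <= `|a%:R - b%:R|.
Proof.
move=> f1 a b; wlog: a b / (a <= b)%N => [hw|].
  by case: (leqP a b) => [/hw //|/ltnW/hw]; rewrite distrC (distrC _ a%:R).
move/subnK <-; elim: (b - a)%N => [|e IHe]; first by rewrite add0n subrr normr0.
apply: (le_trans (ler_distD (f (e + a)%N) _ _)).
rewrite (distrC a%:R) addSn -natr1 addrAC [leRHS]ger0_norm.
  rewrite lerD //; apply: (le_trans IHe).
  by rewrite distrC ger0_norm // subr_ge0 ler_nat leq_addl.
by rewrite addr_ge0 // subr_ge0 ler_nat leq_addl.
Qed.

Definition step_lipschitz (R : realDomainType) (f : nat -> nat -> R) :=
  forall a b, `|f a b - f a.+1 b| <= 1 /\ `|f a b - f a b.+1| <= 1.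

Lemma step_lipschitzP (R : realDomainType) (f : nat -> nat -> R) :
  step_lipschitz f -> forall a a' b b',
  `|f a b - f a' b'| <= `|a%:R - a'%:R| + `|b%:R - b'%:R|.
Proof.
move=> fL a a' b b'; apply: (le_trans (ler_distD (f a' b) _ _)).
apply: lerD; first by apply: (nat_lipschitz (f := f^~ b)) => c; case: (fL c b).
by apply: nat_lipschitz => c; case: (fL a' c).
Qed.

(* [N] times the value of [f] interpolated at [(a / N, b / N)].  The shift is
   common to both arguments, so that [f = 0] on the diagonal is preserved. *)
Definition shift_sum (R : realDomainType) N (f : nat -> nat -> R) a b : R :=
  \sum_(i < N) f ((a + i) %/ N)%N ((b + i) %/ N)%N.

(** Since [a.+1 + i] is [a + i.+1], the sum telescopes to (a + N) / N - a / N. *)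
Lemma sum_divn_shift (R : realDomainType) N a : (0 < N)%N ->
  \sum_(i < N) `|((a + i) %/ N)%N%:R - ((a.+1 + i) %/ N)%N%:R| = 1 :> R.
Proof.
move=> N0; pose f i := ((a + i) %/ N)%N.
have fS i : (f i <= f i.+1)%N by rewrite leq_div2r // leq_add2l.
transitivity ((\sum_(0 <= i < N) (f i.+1 - f i))%N%:R : R).
  rewrite natr_sum big_mkord; apply: eq_bigr => i _.
  rewrite natrB // distrC addSnnS ger0_norm // subr_ge0 ler_nat.
  exact: fS.
rewrite telescope_sumn; last by apply: homo_leq => // ? ? ?; apply: leq_trans.
by rewrite /f addn0 divnDr // divnn N0 addKn.
Qed.

(** Over the [M.*2] shifts the quotient jumps once, by 1; hence it agrees with the middle one on the
    whole half before or after [M]. *)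
Lemma sum_divn_mid (R : realDomainType) M a : (0 < M)%N ->
  \sum_(i < M.*2) `|((a + i) %/ M.*2)%N%:R - ((a + M) %/ M.*2)%N%:R|
    <= M%:R :> R.
Proof.
move=> M0; have N0 : (0 < M.*2)%N by rewrite double_gt0.
rewrite -(big_mkord predT
  (fun i => `|((a + i) %/ M.*2)%N%:R - ((a + M) %/ M.*2)%N%:R|)).
rewrite (big_cat_nat (n := M)) //=; last by lia.
set f := fun i => ((a + i) %/ M.*2)%N.
have fle i j : (i <= j)%N -> (f i <= f j)%N.
  by move=> ij; rewrite leq_div2r // leq_add2l.
have fN : f M.*2 = (f 0%N).+1 by rewrite /f addn0 divnDr // divnn N0 addn1.
have [fM|fM] : f M = f 0%N \/ f M = (f 0%N).+1.
- by have := fle 0%N M isT; have := fle M M.*2; rewrite fN; lia.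
- rewrite big_nat big1 ?add0r => [|i /andP[_ iM]]; last first.
    rewrite -/(f i) -/(f M) (_ : f i = f M) ?subrr ?normr0 //.
    by have := fle 0%N i isT; have := fle i M (ltnW iM); lia.
  rewrite big_nat (le_trans (ler_sum (G := fun=> 1) _ _)) //.
    move=> i /andP[Mi iN]; rewrite -/(f i) -/(f M).
    have : (f i = f M \/ f i = (f M).+1)%N.
      by have := fle M i Mi; have := fle i _ (ltnW iN); lia.
    by case=> ->; rewrite ?subrr ?normr0 // -natr1 addrC addKr normr1.
  rewrite -big_nat sumr_const_nat ler_nat; lia.
- rewrite [X in _ + X]big_nat [X in _ + X]big1 ?addr0 => [|i /andP[Mi iN]].
    rewrite big_nat (le_trans (ler_sum (G := fun=> 1) _ _)) //.
      move=> i /andP[_ iM]; rewrite -/(f i) -/(f M).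
      have : (f i = f M \/ f M = (f i).+1)%N.
        by have := fle 0%N i isT; have := fle i M (ltnW iM); lia.
      case=> ->; rewrite ?subrr ?normr0 // -natr1 distrC addrC addKr normr1 //.
    by rewrite -big_nat sumr_const_nat ler_nat; lia.
  rewrite -/(f i) -/(f M) (_ : f i = f M) ?subrr ?normr0 //.
  by have := fle M i Mi; have := fle i _ (ltnW iN); lia.
Qed.

Lemma shift_sum_lipschitz (R : realDomainType) N (f : nat -> nat -> R) :
  (0 < N)%N -> step_lipschitz f -> step_lipschitz (shift_sum N f).
Proof.
move=> N0 fL a b; split; rewrite /shift_sum -sumrB.
  rewrite -(sum_divn_shift R a N0); apply: (le_trans (ler_norm_sum _ _ _)).
  apply: ler_sum => i _; apply: (le_trans (step_lipschitzP fL _ _ _ _)).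
  by rewrite subrr normr0 addr0.
rewrite -(sum_divn_shift R b N0); apply: (le_trans (ler_norm_sum _ _ _)).
apply: ler_sum => i _; apply: (le_trans (step_lipschitzP fL _ _ _ _)).
by rewrite subrr normr0 add0r.
Qed.

(** Each end point contributes at most [M]; on the scale of [f], the middle rounding is off by at
    most 1. *)
Lemma shift_sum_mid (R : realDomainType) M (f : nat -> nat -> R) a b :
  (0 < M)%N -> step_lipschitz f ->
  `|shift_sum M.*2 f a b -
    f ((a + M) %/ M.*2)%N ((b + M) %/ M.*2)%N * M.*2%:R| <= M.*2%:R.
Proof.
move=> M0 fL; rewrite mulr_natr -[X in _ *+ X]card_ord -sumr_const -sumrB.
apply: (le_trans (ler_norm_sum _ _ _)).
have -> : M.*2%:R = M%:R + M%:R :> R by rewrite -addnn natrD.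
apply: (le_trans _ (lerD (sum_divn_mid R a M0) (sum_divn_mid R b M0))).
rewrite -big_split /=; apply: ler_sum => i _; exact: step_lipschitzP.
Qed.

(** * Divisions of an interval given by grid points *)

Definition cut d m (y : {ffun 'I_d -> nat}) i : nat :=
  if (i <= d)%N then \max_(c < d | (c < i)%N) y c else m.

Lemma cut0 d m (y : {ffun 'I_d -> nat}) : cut m y 0 = 0%N.
Proof. by rewrite /cut big_pred0. Qed.

Lemma cut_last d m (y : {ffun 'I_d -> nat}) : cut m y d.+1 = m.
Proof. by rewrite /cut ltnn. Qed.

Lemma cut_le d m (y : {ffun 'I_d -> nat}) i :
  (forall c, y c <= m)%N -> (cut m y i <= m)%N.
Proof. by move=> ym; rewrite /cut; case: ifP => // _; apply/bigmax_leqP. Qed.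

(** Source of the boundary conditions on labels: y c = 0 makes interval [c] degenerate, and y c = m
    makes all later intervals degenerate. *)
Lemma cutS d m (y : {ffun 'I_d -> nat}) (c : 'I_d) :
  cut m y c.+1 = maxn (cut m y c) (y c).
Proof.
rewrite /cut ltn_ord (ltnW (ltn_ord c)) (bigD1 c) //= maxnC; congr maxn.
by apply: eq_bigl => b; rewrite -val_eqE /=; lia.
Qed.

Lemma leq_cutS d m (y : {ffun 'I_d -> nat}) i :
  (forall c, y c <= m)%N -> (i <= d)%N -> (cut m y i <= cut m y i.+1)%N.
Proof.
move=> ym; rewrite leq_eqVlt => /orP[/eqP ->|id].
  by rewrite cut_last cut_le.
by rewrite (cutS m y (Ordinal id)) leq_maxl.
Qed.

Lemma cut_near (R : realDomainType) d m (x y : {ffun 'I_d -> nat}) i :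
  (forall c, x c <= y c <= (x c).+1)%N ->
  `|(cut m x i)%:R - (cut m y i)%:R| <= 1 :> R.
Proof.
move=> xy; have : (cut m x i <= cut m y i <= (cut m x i).+1)%N.
  rewrite /cut; case: ifP => _; last by rewrite leqnn leqnSn.
  apply/andP; split; apply/bigmax_leqP => c ci; have /andP[xyc yxc] := xy c.
    exact: (leq_trans xyc (leq_bigmax_cond _ ci)).
  apply: (leq_trans yxc); rewrite ltnS.
  exact: (leq_bigmax_cond (F := fun c => x c)).
case/andP=> h1 h2; rewrite distrC ger0_norm ?subr_ge0 ?ler_nat //.
by rewrite lerBlDr addrC natr1 ler_nat.
Qed.

(** Degenerate intervals have value 0, so a maximum over the non-degenerate ones is a maximum over
    all. *)
Lemma max_block_exists (R : realDomainType) d (X : nat -> nat)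
    (f : nat -> nat -> R) :
  X 0%N = 0%N -> (0 < X d.+1)%N -> (forall i, i <= d -> X i <= X i.+1)%N ->
  (forall a b, 0 <= f a b) -> (forall a, f a a = 0) ->
  exists i : 'I_d.+1, (X i < X i.+1)%N &&
    [forall j : 'I_d.+1, f (X j) (X j.+1) <= f (X i) (X i.+1)].
Proof.
move=> X0 Xd Xle f0 fd; pose P (i : 'I_d.+1) := (X i < X i.+1)%N.
have [i0 Pi0|Pn] := pickP P; last first.
  have : forall i, (i <= d.+1)%N -> X i = 0%N.
    elim=> // i IHi id; apply/eqP; rewrite -leqn0 -(IHi (ltnW id)).
    by have := Pn (Ordinal id); rewrite /P /= ltnNge => /negbFE.
  by move=> /(_ d.+1 (leqnn _)) Xd0; rewrite Xd0 in Xd.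
have [i Pi imax] := Order.TotalTheory.arg_maxP
  (fun i : 'I_d.+1 => f (X i) (X i.+1)) Pi0.
exists i; rewrite [(_ < _)%N]Pi; apply/forallP => j.
have [/imax //|] := boolP (P j); rewrite /P -leqNgt => Xj.
suff -> : X j.+1 = X j by rewrite fd.
by apply/eqP; rewrite eqn_leq Xj Xle // -ltnS.
Qed.

(** At a vertex [y] labelled [j], interval [j] has the largest value. Passing from [x] to [y] costs
    2 for each of the intervals [i] and [j], and rounding costs [M.*2] for each. *)
Lemma balanced_cuts_approx (R : realDomainType) (f : nat -> nat -> R) d n M :
  (0 < n)%N -> (0 < M)%N -> step_lipschitz f ->
  (forall a b, 0 <= f a b) -> (forall a, f a a = 0) ->
  exists z : nat -> nat, [/\ z 0%N = 0%N, z d.+1 = n,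
    forall i, (i <= d)%N -> (z i <= z i.+1)%N &
    forall i j : 'I_d.+1, (f (z i) (z i.+1) - f (z j) (z j.+1)) * M.*2%:R
      <= M.*2%:R *+ 2 + 4].
Proof.
move=> n0 M0 fL f0 fd; set N := M.*2; have N0 : (0 < N)%N by rewrite double_gt0.
pose m := (n * N)%N; have m0 : (0 < m)%N by rewrite muln_gt0 n0.
pose V (y : {ffun 'I_d -> nat}) i := shift_sum N f (cut m y i) (cut m y i.+1).
pose P y (i : 'I_d.+1) := (cut m y i < cut m y i.+1)%N &&
  [forall j : 'I_d.+1, V y j <= V y i].
(* The default [ord0] is not reached on the grid, by [max_block_exists]. *)
pose L y : nat := odflt ord0 [pick i | P y i].
have LP (y : {ffun 'I_d -> nat}) : (forall c, y c <= m)%N ->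
    exists2 i : 'I_d.+1, L y = i & P y i.
  move=> ym; rewrite /L; case: pickP => [i Pi|none]; first by exists i.
  have [||i|a b|a|i] := @max_block_exists _ d (cut m y) (shift_sum N f).
  - exact: cut0.
  - by rewrite cut_last.
  - exact: leq_cutS.
  - by apply: sumr_ge0.
  - by apply: big1.
  - by move: (none i); rewrite /P /V => ->.
have [|||x xm xL] := @cubical_sperner d m L m0.
- by move=> y /LP[i -> _]; rewrite -ltnS.
- move=> y c /LP[i -> /andP[yi _]] yc; apply: contraTneq yi => ->.
  by rewrite cutS yc maxn0 ltnn.
- move=> y c ym; have [i -> /andP[yi _]] := LP y ym.
  move=> yc; rewrite leqNgt; apply: contraTN yi => ci.
  rewrite -leqNgt (leq_trans (cut_le _ ym)) //.
  have : (forall j, c < j -> j <= d -> m <= cut m y j)%N.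
    elim=> // j IHj; rewrite ltnS leq_eqVlt => /orP[/eqP <-|cj] jd.
      by rewrite cutS yc leq_maxr.
    by rewrite (leq_trans (IHj cj (ltnW jd))) // leq_cutS // ltnW.
  by apply=> //; rewrite -ltnS.
have VL (y : {ffun 'I_d -> nat}) i : (forall c, x c <= y c <= (x c).+1)%N ->
    `|V x i - V y i| <= 2.
  move=> xy; apply: (le_trans (step_lipschitzP (shift_sum_lipschitz N0 fL) _ _ _ _)).
  by rewrite -[2]/(1 + 1) lerD // cut_near.
(* As [M < M.*2], the middle rounding sends 0 to 0 and [m] to [n]. *)
exists (fun i => (cut m x i + M) %/ N)%N; split.
- by rewrite cut0 add0n divn_small // /N -addnn; lia.
- by rewrite cut_last divnMDl // divn_small ?addn0 // /N -addnn; lia.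
- by move=> i id; rewrite leq_div2r // leq_add2r leq_cutS // => c; apply/ltnW.
move=> i j; have [y xy Ly] := xL j.
have [c] := LP y (fun c => leq_trans (proj2 (andP (xy c))) (xm c)).
rewrite Ly => /val_inj <- /andP[_ /forallP/(_ i) Vij].
have := VL y i xy; have := VL y j xy.
have := shift_sum_mid (cut m x i) (cut m x i.+1) M0 fL.
have := shift_sum_mid (cut m x j) (cut m x j.+1) M0 fL.
rewrite -/N -/(V x i) -/(V x j) !ler_norml mulrBl.
by lra.
Qed.

(** * From functions of end points to blocks *)

(** The gap [e] is the distance from [b] to the least value of [F] above it. *)
Lemma finite_gap (R : realFieldType) (T : finType) (F : T -> R) (b : R) :
  exists2 e, 0 < e & forall t, F t < b + e -> F t <= b.
Proof.
have [t0 Pt0|none] := pickP (fun t => b < F t); last first.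
  by exists 1 => // t _; rewrite leNgt none.
have [t /= Pt tmin] := @Order.TotalTheory.arg_minP _ _ _ t0 (fun t => b < F t) F Pt0.
exists (F t - b) => [|t']; first by rewrite subr_gt0.
rewrite addrC subrK; apply: contraTT; rewrite -ltNge -leNgt => ?; exact: tmin.
Qed.

(** Total in [a] and [b]: empty if [b <= a], truncated at [n]. This allows Lipschitz conditions on
    all of [nat]. *)
Definition nat_interval n a b : {set 'I_n} := [set l : 'I_n | (a <= l < b)%N].

Lemma is_block_interval (T : Type) (A : seq T) a b :
  is_block (nat_interval (size A) a b).
Proof.
have [->|[l0]] := set_0Vmem (nat_interval (size A) a b); first by left.
rewrite inE => /andP[al0 l0b]; right.
have an : (a < size A)%N := leq_ltn_trans al0 (ltn_ord l0).
have bn : ((minn b (size A)).-1 < size A)%N by have := ltn_ord l0; lia.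
exists (Ordinal an), (Ordinal bn); split=> /=; first by have := ltn_ord l0; lia.
by apply/setP => l; rewrite !inE; have := ltn_ord l; lia.
Qed.

Lemma interval_step (T : Type) (A : seq T) (R : realDomainType)
    (s : {set 'I_(size A)} -> R) :
  (forall B1 B2 : {set 'I_(size A)},
     is_block B1 -> is_block B2 -> differ_by_one B1 B2 ->
     `|s B1 - s B2| <= 1) ->
  step_lipschitz (fun a b => s (nat_interval (size A) a b)).
Proof.
move=> sL a b.
(* The changed position [l] is a natural number because it may lie beyond [A]; then the two sets
   coincide. *)
have step a' b' (l : nat) : (forall l' : 'I_(size A), l != l' ->
    (a <= l' < b) = (a' <= l' < b'))%N ->
    `|s (nat_interval (size A) a b) - s (nat_interval (size A) a' b')| <= 1.
  move=> e; set B1 := nat_interval _ _ _; set B2 := nat_interval _ _ _.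
  have [->|/eqP B12] := eqVneq B1 B2; first by rewrite subrr normr0.
  apply: sL; [exact: is_block_interval|exact: is_block_interval|].
  have sub l' : l' \in (B1 :\: B2) :|: (B2 :\: B1) -> l = l'.
    by apply: contraTeq => /e; rewrite !inE => ->; rewrite andNb.
  have [D0|[l0 l0D]] := set_0Vmem ((B1 :\: B2) :|: (B2 :\: B1)).
    case: B12; apply/setP => l'; have /setP/(_ l') := D0; rewrite !inE.
    by case: (a <= l' < b)%N; case: (a' <= l' < b')%N.
  apply/eqP/cards1P; exists l0; apply/setP => l'; rewrite in_set1.
  apply/idP/eqP => [/sub|-> //]; rewrite (sub _ l0D).
  by move=> /val_inj.
split; [apply: (step _ _ a) => l'|apply: (step _ _ b) => l']; lia.
Qed.

Theorem theorem4p2 (R : realType) (T : Type) (A : seq T) (k : nat)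
    (hk : (0 < k)%N) (s : {set 'I_(size A)} -> R)
    (s_empty : s set0 = 0)
    (s_ge0 : forall B : {set 'I_(size A)}, is_block B -> 0 <= s B)
    (s_lip : forall B1 B2 : {set 'I_(size A)},
        is_block B1 -> is_block B2 -> differ_by_one B1 B2 ->
        `|s B1 - s B2| <= 1) :
  exists B : k.-tuple {set 'I_(size A)},
    is_block_partition B /\
    forall i j : 'I_k, `|s (tnth B i) - s (tnth B j)| <= 2.
Proof.
suff [z [z0 zk zle zs]] : exists z : nat -> nat, [/\ z 0%N = 0%N, z k = size A,
    forall i, (i < k)%N -> (z i <= z i.+1)%N &
    forall i j : 'I_k, `|s (nat_interval _ (z i) (z i.+1)) -
                         s (nat_interval _ (z j) (z j.+1))| <= 2].
  exists [tuple nat_interval _ (z i) (z i.+1) | i < k]; split.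
    by exists z; split=> // i; rewrite tnth_mktuple.
  by move=> i j; rewrite !tnth_mktuple.
case: k hk => // d _; have [n0|n0] := posnP (size A).
  exists (fun=> 0%N); split=> // i j.
  by rewrite subrr normr0.
pose f a b := s (nat_interval (size A) a b).
have fL : step_lipschitz f := interval_step s_lip.
have f0 a b : 0 <= f a b by apply/s_ge0/is_block_interval.
have fd a : f a a = 0.
  rewrite /f (_ : nat_interval _ a a = set0) //.
  by apply/setP => l; rewrite !inE; lia.
(* Differences of values of [s] are finite in number, so one below 2 + e is at most 2. *)
have [e e0 gap] := finite_gap
  (fun B : {set 'I_(size A)} * {set 'I_(size A)} => s B.1 - s B.2) 2.
(* This makes the excess 4 / [M.*2] smaller than [e]. *)
have [M M0 Me] : exists2 M, (0 < M)%N & 2 < e * M%:R.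
  exists (Num.bound (2 / e)).+1 => //.
  rewrite -ltr_pdivrMl // mulrC.
  have e2 : 0 <= 2 / e by rewrite divr_ge0 // ltW.
  apply: (lt_le_trans (archi_boundP e2)).
  by rewrite ler_nat.
have [z [z0 zd zle zs]] := balanced_cuts_approx d n0 M0 fL f0 fd.
exists z; split=> // i j.
have hij (i' j' : 'I_d.+1) : f (z i') (z i'.+1) - f (z j') (z j'.+1) <= 2.
  apply: (gap (nat_interval _ (z i') (z i'.+1), nat_interval _ (z j') (z j'.+1))).
  have MM0 : 0 < M.*2%:R :> R by rewrite ltr0n double_gt0.
  rewrite -(ltr_pM2r MM0); apply: (le_lt_trans (zs i' j')).
  rewrite -addnn natrD; lra.
by rewrite ler_norml -/(f _ _) -/(f (z j) _) hij andbT lerNl opprB hij.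
Qed.
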